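(* Let $(X,\operatorname{dist})$ be a compact metric space and let $\phi\colon\mathbb{R}\times X\to X$ be a continuous flow. If $\phi$ is kinematic expansive, then for all $T\in\mathbb{R}$ with $T\neq 0$, the homeomorphism $\phi_T\colon X\to X$ is partially expansive with central dimension $D=1$.
   Context: The flow $\phi$ is kinematic expansive if for all $\epsilon>0$ there is $\delta>0$ such that if $\operatorname{dist}(\phi_t(x),\phi_t(y))<\delta$ for all $t\in\mathbb{R}$ then $y=\phi_s(x)$ for some $s\in(-\epsilon,\epsilon)$. A set is non-trivial if it has more than one point. Given an integer $D\geq -1$, a homeomorphism $f\colon X\to X$ is partially expansive with central dimension $D$ if there is $\epsilon>0$ such that for every non-trivial compact set $C\subset X$ with $\dim(C)>D$ there is $k\in\mathbb{Z}$ with $\operatorname{diam}(f^k(C))\geq\epsilon$. Here $\dim$ is the topological (covering) dimension. *)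

(* Defs.v *)
From mathcomp Require Import all_boot all_order all_algebra.
From mathcomp Require Import all_classical all_reals all_analysis.

Set Implicit Arguments.
Unset Strict Implicit.
Unset Printing Implicit Defensive.

Import Order.TTheory GRing.Theory Num.Theory.
Import numFieldNormedType.Exports.

Local Open Scope classical_set_scope.
Local Open Scope card_scope.
Local Open Scope ring_scope.

Definition continuous_flow (R : realType) (X : topologicalType)
    (phi : R -> X -> X) : Prop :=
  [/\ continuous (fun p : R * X => phi p.1 p.2),
      forall x, phi 0 x = x &
      forall s t x, phi (s + t) x = phi s (phi t x)].

Definition kinematic_expansive (R : realType) (X : metricType R)
    (phi : R -> X -> X) : Prop :=
  forall eps : R, 0 < eps -> exists2 delta : R, 0 < delta &
    forall x y : X, (forall t : R, mdist (phi t x) (phi t y) < delta) ->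
      exists2 s : R, - eps < s < eps & y = phi s x.

Definition nontrivial_set (X : Type) (C : set X) : Prop :=
  exists x y, [/\ C x, C y & x <> y].

(* On a nonempty set with bounded distances this is the usual diameter;
   elsewhere it takes the junk value 0 of the real-valued sup. *)
Definition diam (R : realType) (X : metricType R) (C : set X) : R :=
  sup [set mdist x y | x in C & y in C].

Definition finite_open_cover (S : topologicalType) (U : set (set S)) : Prop :=
  [/\ finite_set U, forall A, U A -> open A & \bigcup_(A in U) A = [set: S]].

Definition refines (S : Type) (V U : set (set S)) : Prop :=
  forall B, V B -> exists2 A, U A & B `<=` A.

(* dim S <= D: every finite open cover has a finite open refinement covering S
   in which no point belongs to more than D + 1 members.  The dimension of a
   space is at least -1, with equality exactly for the empty space; the first
   conjunct also makes absz (D + 1) the number D + 1. *)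
Definition covering_dim_le (S : topologicalType) (D : int) : Prop :=
  -1 <= D /\
  forall U : set (set S), finite_open_cover U ->
    exists V : set (set S), [/\ finite_open_cover V, refines V U &
      forall x : S, [set B | V B /\ B x] #<= `I_(absz (D + 1)%R)].

(* As usual in dimension theory (the value may be infinite), dim S > D means
   that dim S <= D fails. *)
Definition covering_dim_gt (S : topologicalType) (D : int) : Prop :=
  ~ covering_dim_le S D.

Definition inverse_homeomorphisms (X : topologicalType) (f g : X -> X) : Prop :=
  [/\ continuous f, continuous g, cancel f g & cancel g f].

(* The integer iterate f^k of a bijection f with inverse g. *)
Definition iterz (X : Type) (f g : X -> X) (k : int) : X -> X :=
  match k with
  | Posz n => iter n f
  | Negz n => iter n.+1 g
  end.

(* f is a homeomorphism (its inverse g being unique) that is partially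
   expansive with central dimension D; a subset C carries the subspace
   topology, which is the topology of the type [set_type C]. *)
Definition partially_expansive (R : realType) (X : metricType R)
    (D : int) (f : X -> X) : Prop :=
  -1 <= D /\
  exists2 g : X -> X, inverse_homeomorphisms f g &
    exists2 eps : R, 0 < eps &
      forall C : set X, nontrivial_set C -> compact C ->
        covering_dim_gt (set_type C) D ->
        exists k : int, eps <= diam (iterz f g k @` C).

(* Main.v *)
Require Import Defs.
From mathcomp Require Import all_boot all_order all_algebra.
From mathcomp Require Import all_classical all_reals all_analysis.
From mathcomp Require Import lra.

(** Choose a small [a > 0].  Kinematic expansivity at scale [a] gives [delta],
and uniform continuity of the flow over the times of [[-|T|, |T|]] turns
[delta] into an [e] such that two points whose orbits under [phi T] stay
[e]-close have [delta]-close orbits under the whole flow, since every real time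
is an integer multiple of [T] plus a time in [[-|T|, |T|]].  This [e] is the
expansivity constant: if all iterates of [C] have diameter less than [e] and
[x] is a point of [C], then every point of [C] is [phi s x] with [|s| < a], so
[C] lies on the short orbit arc [{phi s x : |s| <= a}].

A continuous image of a segment can have any dimension, so the dimension of [C]
is bounded only because the arc is embedded, which requires that the points
that are not fixed have no small periods ([no_small_periods]).  This is where
expansivity enters a second time: periodic points with periods tending to 0
accumulate at a fixed point [z], near which their whole orbits remain close to
[z]; expansivity then puts them on the orbit of [z], so they are equal to [z].
With [a] a third of a lower bound for the periods, the time parameter is
injective on [[-a, a]]; the parameter of a point of [C] is then a continuous
injective function on [C].

A compact space with a continuous injective real function [tau] has dimension
at most 1 ([dim_le1_of_real_embedding]): a cover has a Lebesgue number for
[tau], and the preimages of the intervals of radius [d] around the multiples of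
[d], for small [d], form a refinement in which each point lies at most twice.

The uniformity statements are all obtained from the near-covering form of
compactness: what holds near each point, eventually along a filter of
parameters, holds eventually on the whole compact set. *)

Set Implicit Arguments.
Unset Strict Implicit.
Unset Printing Implicit Defensive.

Import Order.TTheory GRing.Theory Num.Theory.
Import numFieldNormedType.Exports.

Local Open Scope classical_set_scope.
Local Open Scope ring_scope.

(** * Spaces that inject continuously into the line *)

Lemma compact_set_type (X : topologicalType) (C : set X) :
  compact C -> compact [set: set_type C].
Proof.
move=> cC F PF _.
have FC : (set_val @ F) C.
  apply: (@filterS _ F _ setT) => [c _|]; last exact: filterT.
  exact: set_mem (valP c).
have [p [Cp clp]] := cC (set_val @ F) _ FC.
exists (SigSub (mem_set Cp)); split => // A B FA.
move=> [_ [[W oW <-] /= Wp] WB].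
have FA' : (set_val @ F) (set_val @` A).
  by apply: (@filterS _ F _ A) => // c Ac; exists c.
have [_ [[c Ac <-] Wc]] := clp _ W FA' (open_nbhs_nbhs (conj oW Wp)).
by exists c; split => //; exact: WB.
Qed.

(** A continuous injection of a compact set [K] into a Hausdorff space is
closed, so its inverse is continuous; [tau] is that inverse, on a subset [C] of
the image. *)
Lemma continuous_inverse_on_image (Y X : topologicalType) (K : set Y)
    (h : Y -> X) (C : set X) (tau : set_type C -> Y) :
  hausdorff_space X -> compact K -> continuous h -> {in K &, injective h} ->
  (forall c, K (tau c) /\ h (tau c) = set_val c) -> continuous tau.
Proof.
move=> hX cK ch hinj tauP c B; rewrite nbhsE => -[B' [oB' B'c] B'B].
pose W := ~` (h @` (K `&` ~` B')).
have oW : open W.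
  apply: closed_openC; apply: compact_closed => //.
  apply: continuous_compact; first exact: continuous_subspaceT.
  by apply: compact_closedI => //; exact: open_closedC.
have Wc : W (set_val c).
  move=> [y [Ky nB']]; case: (tauP c) => Kc <- /hinj.
  by rewrite !inE => /(_ Ky Kc) yc; apply: nB'; rewrite yc.
exists (set_val @^-1` W); split => //=; first by exists W.
move=> c' Wc'; apply: B'B; apply: contrapT => nB'.
by apply: Wc'; case: (tauP c') => Kc' <-; exists (tau c').
Qed.

(** Compactness makes [tau] an embedding: if [A] is an open neighbourhood of
[s], then [tau] maps the complement of [A] to a closed set that misses [tau s],
so that [A] contains the preimage of an interval around [tau s]. *)
Lemma lebesgue_number_real (R : realType) (S : topologicalType) (tau : S -> R)
    (U : set (set S)) :
  compact [set: S] -> continuous tau -> injective tau ->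
  (forall A, U A -> open A) -> \bigcup_(A in U) A = [set: S] ->
  exists2 w : R, 0 < w & forall s, exists2 A, U A &
    forall s', `|tau s - tau s'| < w -> A s'.
Proof.
move=> cS ct tinj Uo Uc.
have : \forall w \near 0^'+, [set: S] `<=` (fun s => exists2 A, U A &
    forall s', `|tau s - tau s'| < w -> A s').
  apply: (iffLR (compact_near_coveringP _)) => // s _.
  have : [set: S] s by [].
  rewrite -Uc => -[A UA As].
  have cl : closed (tau @` (~` A)).
    apply: compact_closed; first exact: Rhausdorff.
    apply: continuous_compact; first exact: continuous_subspaceT.
    rewrite -(setTI (~` A)); apply: compact_closedI => //.
    by apply: open_closedC; exact: Uo.
  have : nbhs (tau s) (~` (tau @` (~` A))).
    apply: open_nbhs_nbhs; split; first exact: closed_openC.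
    by move=> [s' nAs' /tinj s's]; apply: nAs'; rewrite s's.
  move=> /nbhs_ballP[r /= r0 rA].
  have r20 : 0 < r / 2 by rewrite divr_gt0.
  (* Half the radius serves all the points near [s], not only [s] itself. *)
  near=> s' w; exists A => // s'' ss''.
  apply: contrapT => nA.
  apply: (rA (tau s'')); last by exists s''.
  rewrite /ball/=.
  have h1 : `|tau s - tau s'| < r / 2.
    near: s'.
    by move: (ct s) => /cvgrPdist_lt /(_ _ r20).
  have h2 : w < r / 2 by near: w; apply: nbhs_right_lt.
  rewrite (le_lt_trans (ler_distD (tau s') _ _))// (splitr r) ltrD//.
  exact: lt_trans h2.
move=> H; near (0 : R)^'+ => w; exists w => //.
by move=> s; apply: (near H w).
Unshelve. all: end_near. Qed.

Lemma compact_real_bounded (R : realType) (S : topologicalType) (tau : S -> R) :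
  compact [set: S] -> continuous tau -> exists M : R, forall s, `|tau s| < M.
Proof.
move=> cS ct.
have [M [_ HM]] : bounded_set (tau @` [set: S]).
  apply: compact_bounded; apply: continuous_compact => //.
  exact: continuous_subspaceT.
exists (M + 2) => s; have M1 : M < M + 1 by rewrite ltrDl.
have /= tM := HM _ M1 (tau s) (ex_intro2 _ _ s I erefl).
by rewrite (le_lt_trans tM)// ltrD2l ltr1n.
Qed.

Lemma card_le_pair (T : Type) (F : nat -> T) (m : nat) (V : set T) :
  V `<=` [set F m; F m.+1] -> (V #<= `I_2)%card.
Proof.
move=> VF.
apply: card_le_trans (subset_card_le VF) _.
have -> : [set F m; F m.+1] = (fun i => F (m + i)%N) @` `I_2.
  apply/seteqP; split=> [_ [->|->]|_ [[|[|//]] _ <-]].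
  - by exists 0%N => //; rewrite addn0.
  - by exists 1%N => //; rewrite addn1.
  - by left; rewrite addn0.
  - by right; rewrite addn1.
exact: card_image_le.
Qed.

(** The refinement consists of the sets where [u], an affine rescaling of [tau],
is at distance less than 1 from a given natural number.  A nonnegative real is
that close to at most two of them, its integer part and the successor. *)
Lemma dim_le1_of_real_embedding (R : realType) (S : topologicalType)
    (tau : S -> R) :
  compact [set: S] -> continuous tau -> injective tau -> covering_dim_le S 1.
Proof.
move=> cS ct tinj; split=> // U [_ Uo Uc].
have [w w0 Hw] := lebesgue_number_real cS ct tinj Uo Uc.
have [M HM] := compact_real_bounded cS ct.
(* Two points in the same interval of radius [d] differ by less than [w]. *)
pose d : R := w / 2.
have d0 : 0 < d by rewrite divr_gt0.
(* The shift by [M] makes [u] nonnegative, and hence the members of the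
   refinement indexed by natural numbers. *)
pose u s := (tau s + M) / d.
have u0 s : 0 <= u s.
  by rewrite divr_ge0 ?ltW//; have := HM s; rewrite ltr_norml => /andP[]; lra.
have uN s : u s <= 2 * M / d.
  rewrite ler_pM2r ?invr_gt0//.
  by have := HM s; rewrite ltr_norml => /andP[]; lra.
have ucont : continuous u.
  move=> s; apply: cvgMl; apply: cvgD; [exact: ct|exact: cvg_cst].
pose F (k : nat) : set S := [set s | `|u s - k%:R| < 1].
pose N := (Num.truncn (2 * M / d)).+2.
have FN s k : F k s -> (k < N)%N.
  rewrite /F/= ltr_norml => /andP[h1 _].
  rewrite /N -(ltr_nat R) -natr1.
  have := uN s; have := truncnS_gt (2 * M / d); lra.
have Fm s k : F k s -> k = Num.truncn (u s) \/ k = (Num.truncn (u s)).+1.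
  rewrite /F/= ltr_norml => /andP[h1 h2].
  have /andP[m1 m2] := truncn_itv (u0 s).
  have : (k < (Num.truncn (u s)).+2)%N.
    by rewrite -(ltr_nat R) -natr1; lra.
  have : (Num.truncn (u s) < k.+1)%N.
    by rewrite -(ltr_nat R) -natr1; lra.
  rewrite !ltnS leq_eqVlt => /orP[/eqP ->|h]; first by left.
  by rewrite leq_eqVlt ltnS => /orP[/eqP ->|]; [right|rewrite leqNgt h].
have Fself s : F (Num.truncn (u s)) s.
  rewrite /F/= ltr_norml.
  have /andP[m1] := truncn_itv (u0 s).
  by rewrite -natr1 => m2; apply/andP; split; lra.
(* Nonempty members only: an empty one need not lie in a member of [U], since
   [U] may be empty. *)
exists [set F k | k in [set k | F k !=set0]]; split.
- split.
  + apply: (@sub_finite_set _ _ (F @` `I_N)); last exact/finite_image/finite_II.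
    by move=> _ [k [s Fks] <-]; exists k => //; exact: FN Fks.
  + move=> _ [k _ <-].
    have -> : F k = u @^-1` (ball (k%:R : R) 1).
      by apply/seteqP; split=> s; rewrite /F /ball /= distrC.
    apply: open_comp; last exact: ball_open.
    by move=> s _; exact: ucont.
  + apply/seteqP; split=> // s _; exists (F (Num.truncn (u s))) => //.
    by exists (Num.truncn (u s)) => //; exists s.
- move=> _ [k [s Fks] <-]; have [A UA HA] := Hw s; exists A => // s' Fks'.
  apply: HA.
  have : `|u s - u s'| < 2.
    rewrite (le_lt_trans (ler_distD k%:R _ _))// (_ : 2 = 1 + 1)// ltrD//.
    by rewrite distrC.
  rewrite /u -mulrBl normrM (gtr0_norm (_ : 0 < d^-1)) ?invr_gt0//.
  rewrite ltr_pdivrMr// (_ : tau s + M - _ = tau s - tau s'); last lra.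
  by rewrite /d mulrCA divff ?mulr1.
- move=> s; apply: (@card_le_pair _ F (Num.truncn (u s))).
  by move=> _ [[k _ <-] /Fm[->|->]]; [left|right].
Qed.

(** For [C] contained in an injective arc, the embedding [tau] into the line is
the parameter on the arc. *)
Lemma dim_le1_of_injective_arc (R : realType) (X : topologicalType)
    (K : set R) (h : R -> X) (C : set X) :
  hausdorff_space X -> compact K -> continuous h -> {in K &, injective h} ->
  compact C -> C `<=` h @` K -> covering_dim_le (set_type C) 1.
Proof.
move=> hX cK ch hinj cC CK.
have /choice[tau tauP] : forall c : set_type C,
    exists s, K s /\ h s = set_val c.
  by move=> c; have [s Ks hs] := CK _ (set_mem (valP c)); exists s.
apply: (@dim_le1_of_real_embedding _ _ tau).
- exact: compact_set_type.
- exact: continuous_inverse_on_image tauP.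
- move=> c c' cc'; apply: val_inj.
  have [_ hc] := tauP c; have [_ hc'] := tauP c'.
  exact: etrans (esym hc) (etrans (congr1 h cc') hc').
Qed.

(** * Distances in compact metric spaces *)

Lemma compact_mdist_bounded (R : realType) (X : metricType R) :
  compact [set: X] -> exists M : R, forall x y : X, mdist x y <= M.
Proof.
move=> cX.
have [[x0]|noX] := pselect (inhabited X); last first.
  by exists 0 => x; exfalso; apply: noX.
have H : \forall M \near (+oo : set_system R),
    [set: X] `<=` (fun x => mdist x0 x < M).
  apply: (iffLR (compact_near_coveringP _)) => // y _.
  near=> x M.
  have yM : mdist x0 y + 1 < M.
    by near: M; apply: nbhs_pinfty_gt; exact: num_real.
  have yx : mdist y x < 1.
    near: x; apply/metricType_numDomainType.nbhs_mdistP.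
    by exists 1; first exact: ltr01.
  rewrite (le_lt_trans (metric_triangle _ y _))//.
  by rewrite (le_lt_trans _ yM)// lerD2l ltW.
near (+oo : set_system R) => B; exists (B + B) => x y.
have x0M z : mdist x0 z <= B by apply: ltW; exact: (near H B).
by rewrite (le_trans (metric_triangle _ x0 _))// lerD// metric_sym.
Unshelve. all: end_near. Qed.

(** The diameter is a real supremum, which bounds the distances only because
compactness makes them bounded. *)
Lemma mdist_le_diam (R : realType) (X : metricType R) (C : set X) (x y : X) :
  compact [set: X] -> C x -> C y -> mdist x y <= diam C.
Proof.
move=> /compact_mdist_bounded[M HM] Cx Cy; apply: ub_le_sup.
  by exists M => _ [x' _ [y' _ <-]].
by exists x => //; exists y.
Qed.

(** * Uniform continuity of flows *)

Lemma flow_time_continuous (R : realType) (X : topologicalType)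
    (phi : R -> X -> X) (T : R) : continuous_flow phi -> continuous (phi T).
Proof.
move=> [cphi _ _] x.
apply: (@continuous_comp _ _ _ (fun y => (T, y)) (fun p => phi p.1 p.2)).
  move=> P [[A B] /= [nA nB] AB]; apply: filterS nB => y By.
  by apply: AB; split => //=; exact: nbhs_singleton nA.
exact: cphi.
Qed.

Lemma orbit_continuous (R : realType) (X : topologicalType)
    (phi : R -> X -> X) (x : X) :
  continuous_flow phi -> continuous (fun s => phi s x).
Proof.
move=> [cphi _ _] s.
apply: (@continuous_comp _ _ _ (fun s => (s, x)) (fun p => phi p.1 p.2)).
  move=> P [[A B] /= [nA nB] AB]; apply: filterS nA => t At.
  by apply: AB; split => //=; exact: nbhs_singleton nB.
exact: cphi.
Qed.

(** Joint continuity at the points [(t0, z)] for all [z], made uniform in [z].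
Only the time of the first point varies: with [x = y] this compares two times,
and two uses of it compare two points at a common time. *)
Lemma flow_equicontinuous (R : realType) (X : metricType R) (phi : R -> X -> X)
    (t0 eta : R) :
  compact [set: X] -> continuous_flow phi -> 0 < eta ->
  \forall s \near t0 & e \near 0^'+,
    forall x y, mdist x y < e -> mdist (phi s x) (phi t0 y) < eta.
Proof.
move=> cX [cphi _ _] eta0.
have eta20 : 0 < eta / 2 by rewrite divr_gt0.
have near_phi z : \forall s \near t0 & x \near z,
    mdist (phi t0 z) (phi s x) < eta / 2.
  by have /metricType_numDomainType.cvgr_dist_lt/(_ _ eta20) := cphi (t0, z).
have : \forall q \near filter_prod (nbhs t0) (0 : R)^'+, [set: X] `<=`
    (fun x => forall y, mdist x y < q.2 -> mdist (phi q.1 x) (phi t0 y) < eta).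
  apply: (iffLR (compact_near_coveringP _)) => // z _.
  have [[A B]/= [nA nB] AB] := near_phi z.
  have /metricType_numDomainType.nbhs_mdistP[r /= r0 rB] := nB.
  have r20 : 0 < r / 2 by rewrite divr_gt0.
  near=> x q => y xy.
  have q2 : q.2 < r / 2.
    near: q; exists (setT, [set e | e < r / 2]) => /=; last by case=> ? ? [].
    by split; [exact: filterT | exact: nbhs_right_lt].
  have Aq : A q.1.
    near: q; exists (A, setT) => /=; last by case=> ? ? [].
    by split; [|exact: filterT].
  have zx : mdist z x < r / 2.
    by near: x; apply/metricType_numDomainType.nbhs_mdistP; exists (r / 2).
  have Bx : B x.
    apply: rB => /=.
    by rewrite (lt_le_trans zx)// ler_pdivrMr// ler_pMr// ler1n.
  have By : B y.
    apply: rB => /=; rewrite (le_lt_trans (metric_triangle z x y))//.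
    by rewrite (splitr r) ltrD// (lt_trans xy).
  rewrite (le_lt_trans (metric_triangle _ (phi t0 z) _))// (splitr eta) ltrD//.
    by rewrite metric_sym; exact: (AB (q.1, x)).
  by apply: (AB (t0, y)); split => //=; exact: nbhs_singleton nA.
by apply: filterS => -[s e] /= H x y; exact: H.
Unshelve. all: end_near. Qed.

Lemma flow_small_time (R : realType) (X : metricType R) (phi : R -> X -> X)
    (eta : R) :
  compact [set: X] -> continuous_flow phi -> 0 < eta ->
  exists2 rho, 0 < rho & forall s x, `|s| < rho -> mdist (phi s x) x < eta.
Proof.
move=> cX fphi eta0; have [_ phi0 _] := fphi.
have [[A B]/= [nA nB] AB] := flow_equicontinuous 0 cX fphi eta0.
have /nbhs_ballP[rho /= rho0 rhoA] := nA.
exists rho => // s x srho.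
near (0 : R)^'+ => e.
have := AB (s, e) _ x x; rewrite /= phi0 mdistxx; apply => //.
split => /=; last by near: e.
by apply: rhoA; rewrite /ball/= sub0r normrN.
Unshelve. all: end_near. Qed.

Lemma flow_uniform_on_segment (R : realType) (X : metricType R)
    (phi : R -> X -> X) (T eta : R) :
  compact [set: X] -> continuous_flow phi -> 0 < eta ->
  exists2 e, 0 < e & forall x y s, mdist x y < e -> `|s| <= T ->
    mdist (phi s x) (phi s y) < eta.
Proof.
move=> cX fphi eta0; have eta20 : 0 < eta / 2 by rewrite divr_gt0.
have H : \forall e \near 0^'+, `[- T, T] `<=`
    (fun s => forall x y, mdist x y < e -> mdist (phi s x) (phi s y) < eta).
  apply: (iffLR (compact_near_coveringP _)); first exact: segment_compact.
  move=> t _; have := flow_equicontinuous t cX fphi eta20.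
  move=> [[A B]/= [nA nB] AB].
  near=> s e => x y xy.
  have ABse : (A `*` B) (s, e) by split => /=; [near: s|near: e].
  have e0 : 0 < e by near: e; exact: nbhs_right_gt.
  rewrite (le_lt_trans (metric_triangle _ (phi t y) _))// (splitr eta) ltrD//.
    exact: (AB _ ABse).
  by rewrite metric_sym; apply: (AB _ ABse); rewrite mdistxx.
near (0 : R)^'+ => e; exists e => // x y s xy sT.
by apply: (near H e) => //=; rewrite in_itv/= -ler_norml.
Unshelve. all: end_near. Qed.

(** * Iterates of a time map and periods *)

Lemma real_euclidean_division (R : realType) (p t : R) : p != 0 ->
  exists (k : int) (r : R), t = r + k%:~R * p /\ `|r| <= `|p|.
Proof.
move=> p0; pose k := Num.floor (t / p); exists k, (t - k%:~R * p).
split; first by rewrite subrK.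
have -> : t - k%:~R * p = (t / p - k%:~R) * p by rewrite mulrBl divfK.
rewrite normrM ler_piMl//.
have /andP[] := real_floor_itv (num_real (t / p)); rewrite -/k intrD => k1 k2.
by rewrite ler_norml; apply/andP; split; lra.
Qed.

Lemma flow_iterz (R : realType) (X : topologicalType) (phi : R -> X -> X)
    (T : R) (k : int) (x : X) :
  continuous_flow phi -> iterz (phi T) (phi (- T)) k x = phi (k%:~R * T) x.
Proof.
move=> [_ phi0 phiD].
have it S n : iter n (phi S) x = phi (n%:R * S) x.
  elim: n => [|n IH] /=; first by rewrite mul0r phi0.
  by rewrite IH -phiD -natr1 mulrDl mul1r addrC.
case: k => n; first exact: it.
by rewrite /iterz it NegzE mulrNz mulNr mulrN.
Qed.

Lemma period_reduce (R : realType) (X : topologicalType) (phi : R -> X -> X)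
    (p t : R) (x : X) :
  continuous_flow phi -> p != 0 -> phi p x = x ->
  exists2 r, `|r| <= `|p| & phi t x = phi r x.
Proof.
move=> fphi p0 px; have [k [r [-> rp]]] := real_euclidean_division t p0.
exists r => //.
have [_ phi0 phiD] := fphi.
have px' : phi (- p) x = x by rewrite -[in LHS]px -phiD addNr phi0.
rewrite phiD -(flow_iterz p k x fphi).
have it y S n : phi S y = y -> iter n (phi S) y = y.
  by move=> Sy; elim: n => //= n ->.
by case: k => n; rewrite /iterz it.
Qed.

(** Periods of the points that are not fixed are bounded below.  By compactness
it suffices to find, for each [z], a bound that holds near [z]. *)
Lemma no_small_periods (R : realType) (X : metricType R) (phi : R -> X -> X) :
  compact [set: X] -> continuous_flow phi -> kinematic_expansive phi ->
  exists2 p0 : R, 0 < p0 & forall x p, 0 < p < p0 -> phi p x = x ->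
    forall t, phi t x = x.
Proof.
move=> cX fphi kphi; have [cphi phi0 phiD] := fphi.
have H : \forall q \near 0^'+, [set: X] `<=`
    (fun x => forall p, 0 < p < q -> phi p x = x -> forall t, phi t x = x).
  apply: (iffLR (compact_near_coveringP _)) => // z _.
  (* If [z] is fixed, the whole orbit of [x] stays close to the orbit of [z], so
     that [x = z] by expansivity; if [phi t0 z <> z], reducing [t0] modulo a
     small period shows that [phi t0 x] is close to [x], hence [phi t0 z] to
     [z], too close for the choice of [eta]. *)
  have [zfix|/existsNP[t0 zt0]] := pselect (forall t, phi t z = z).
    (* Any scale will do here: the orbit of [z] is a single point. *)
    have [delta delta0 kd] := kphi 1 ltr01.
    have d20 : 0 < delta / 2 by rewrite divr_gt0.
    have [rho rho0 Hrho] := flow_small_time cX fphi d20.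
    near=> x q => p /andP[pp pq] px t.
    have qrho : q < rho by near: q; exact: nbhs_right_lt.
    have zx : mdist z x < delta / 2.
      near: x; apply/metricType_numDomainType.nbhs_mdistP.
      by exists (delta / 2).
    have [|s _ ->] := kd z x; last by rewrite !zfix.
    move=> t'; rewrite zfix.
    have [r rp ->] := period_reduce t' fphi (lt0r_neq0 pp) px.
    rewrite (le_lt_trans (metric_triangle _ x _))// (splitr delta) ltrD//.
    rewrite metric_sym Hrho// (le_lt_trans rp)// gtr0_norm//.
    exact: lt_trans qrho.
  pose eta := mdist (phi t0 z) z / 3.
  have eta0 : 0 < eta by rewrite divr_gt0// mdist_gt0; exact/eqP.
  have [rho rho0 Hrho] := flow_small_time cX fphi eta0.
  have [[A B]/= [nA nB] AB] := flow_equicontinuous t0 cX fphi eta0.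
  near (0 : R)^'+ => e.
  have e0 : 0 < e by near: e; exact: nbhs_right_gt.
  have Be : B e by near: e.
  near=> x q => p /andP[pp pq] px t; exfalso.
  have qrho : q < rho by near: q; exact: nbhs_right_lt.
  have zxe : mdist z x < e.
    by near: x; apply/metricType_numDomainType.nbhs_mdistP; exists e.
  have zx : mdist z x < eta.
    by near: x; apply/metricType_numDomainType.nbhs_mdistP; exists eta.
  have [r rp pr] := period_reduce t0 fphi (lt0r_neq0 pp) px.
  have := metric_triangle (phi t0 z) (phi t0 x) z.
  have := metric_triangle (phi t0 x) x z.
  have : mdist (phi t0 z) (phi t0 x) < eta.
    by apply: (AB (t0, e)) => //; split => //=; exact: nbhs_singleton nA.
  have : mdist (phi t0 x) x < eta.
    rewrite pr Hrho// (le_lt_trans rp)// gtr0_norm//.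
    exact: lt_trans qrho.
  have : mdist x z < eta by rewrite metric_sym.
  by rewrite /eta; lra.
near (0 : R)^'+ => q; exists q => // x p pq; exact: (near H q).
Unshelve. all: end_near. Qed.

(** * Partial expansivity *)

Theorem proposition2p9 (R : realType) (X : metricType R)
    (Xcompact : compact [set: X]) (phi : R -> X -> X)
    (phi_flow : continuous_flow phi)
    (phi_kin : kinematic_expansive phi) :
  forall T : R, T != 0 -> partially_expansive 1 (phi T).
Proof.
move=> T T0; split => //; have [_ phi0 phiD] := phi_flow.
exists (phi (- T)).
  split; try exact: flow_time_continuous.
    by move=> x; rewrite -phiD addNr phi0.
  by move=> x; rewrite -phiD subrr phi0.
have [p0 p0_gt0 noper] := no_small_periods Xcompact phi_flow phi_kin.
(* Two parameters in [[-a, a]] differ by at most [2 * p0 / 3 < p0]. *)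
pose a := p0 / 3; have a0 : 0 < a by rewrite divr_gt0.
have [delta delta0 kin] := phi_kin a a0.
have [e e0 unif] := flow_uniform_on_segment `|T| Xcompact phi_flow delta0.
exists e => // C [x [y [Cx Cy xy]]] cC dimC; apply: contrapT => small.
apply: dimC.
have close t y' : C y' -> mdist (phi t x) (phi t y') < delta.
  move=> Cy'; have [k [r [-> rT]]] := real_euclidean_division t T0.
  rewrite !phiD -!(flow_iterz T k _ phi_flow); apply: unif => //.
  rewrite ltNge; apply/negP => far; apply: small; exists k.
  by rewrite (le_trans far)// mdist_le_diam//; [exists x|exists y'].
have arc y' : C y' -> exists2 s, - a < s < a & y' = phi s x.
  by move=> Cy'; apply: kin => t; exact: close.
have xmoves : ~ forall t, phi t x = x.
  by move=> xfix; apply: xy; have [s _ ->] := arc y Cy; rewrite xfix.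
have inj_lt s s' : s < s' -> s' - s < p0 -> phi s x <> phi s' x.
  move=> ss' sp ssx; apply: xmoves; apply: (noper x (s' - s)).
    by rewrite subr_gt0 ss'.
  by rewrite addrC phiD -ssx -phiD addNr phi0.
apply: (@dim_le1_of_injective_arc _ _ `[- a, a] (fun s => phi s x)) => //.
- exact: metric_hausdorff.
- exact: segment_compact.
- exact: orbit_continuous.
- move=> s s'; rewrite !inE /= !in_itv/= => /andP[s1 s2] /andP[s3 s4] ss'.
  have : s' - s < p0 /\ s - s' < p0 by rewrite /a in s1 s2 s3 s4; lra.
  move=> [d1 d2]; have [lt|lt|//] := ltgtP s s'.
    by case: (inj_lt _ _ lt d1 ss').
  by case: (inj_lt _ _ lt d2 (esym ss')).
- move=> y' /arc[s /andP[s1 s2] ->]; exists s => //=.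
  by rewrite in_itv/= !ltW.
Qed.
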